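(* Let $Q\in\mathbb{R}^{m\times m}$ be symmetric, $B\in\mathbb{R}^{n\times m}$, $b\in\mathbb{R}^n$, let $K=\{x\in\{0,1\}^m: Bx=b\}$ be nonempty and let $\bar K=\{x\in\mathbb{R}^m: x\ge 0,\ Bx=b\}$. Assume that $x\le e$ is redundant for $\bar K$, i.e. every $x\in\bar K$ satisfies $x\le e$. Then $$v_{LBB'}=v_{RLT_1'}=v_{RLT_1},$$ where $v_{LBB'}$, $v_{RLT_1'}$ and $v_{RLT_1}$ are the optimal values defined in the context.
   Context: Inequalities between vectors or matrices are entrywise; $e$ is the all-ones vector of length $m$, $J$ the all-ones $m\times m$ matrix, $\mathcal{S}^m$ the set of real symmetric $m\times m$ matrices, $\langle\cdot,\cdot\rangle$ the trace (or Euclidean) inner product, $\mathrm{Diag}(z)$ the diagonal matrix with diagonal $z$, $\mathrm{diag}(X)$ the vector of diagonal entries of $X$. Optimal values are taken in $\mathbb{R}\cup\{\pm\infty\}$. Linearization-based bound: $$v_{LBB'}=\max_{Y\in\mathbb{R}^{n\times m},\,z\in\mathbb{R}^m,\,y\in\mathbb{R}^n}\{b^{\mathrm T}y : B^{\mathrm T}y\le 2Y^{\mathrm T}b+z,\ B^{\mathrm T}Y+Y^{\mathrm T}B+\mathrm{Diag}(z)\le Q\}.$$ Let $\mathcal{F}=\{(x,X)\in\mathbb{R}^m\times\mathcal{S}^m : Bx=b,\ BX=bx^{\mathrm T},\ x=\mathrm{diag}(X),\ x\ge0,\ X\ge0\}$. Reduced first level RLT relaxation: $v_{RLT_1'}=\min\{\langle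 Q,X\rangle : (x,X)\in\mathcal{F}\}$. First level RLT relaxation: $v_{RLT_1}=\min\{\langle Q,X\rangle : (x,X)\in\mathcal{F},\ e-x\ge0,\ J-xe^{\mathrm T}-ex^{\mathrm T}+X\ge0,\ xe^{\mathrm T}-X\ge0\}$. *)

(* Defs.v *)
From mathcomp Require Import all_boot all_order all_algebra.
From mathcomp Require Import all_classical all_reals ereal.

Set Implicit Arguments.
Unset Strict Implicit.
Unset Printing Implicit Defensive.

Import Order.TTheory GRing.Theory Num.Theory.

Local Open Scope classical_set_scope.
Local Open Scope ring_scope.

Definition lemx (R : numDomainType) (p q : nat) (A C : 'M[R]_(p, q)) : Prop :=
  forall i j, A i j <= C i j.

Notation "A <=mx C" := (lemx A C) (at level 70, no associativity) : ring_scope.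

(* At q = 1 this is the Euclidean inner product of column vectors. *)
Definition mxdot (R : numDomainType) (p q : nat) (A C : 'M[R]_(p, q)) : R :=
  \tr (A^T *m C).

Definition diag_col (R : numDomainType) (m : nat) (X : 'M[R]_m) : 'cV[R]_m :=
  \col_i X i i.

Definition ones (R : numDomainType) (m : nat) : 'cV[R]_m := const_mx 1.

Definition binary_set (R : numDomainType) (m n : nat)
    (B : 'M[R]_(n, m)) (b : 'cV[R]_n) : set 'cV[R]_m :=
  [set x : 'cV[R]_m | (forall i, x i 0 = 0 \/ x i 0 = 1) /\ B *m x = b].

Definition continuous_set (R : numDomainType) (m n : nat)
    (B : 'M[R]_(n, m)) (b : 'cV[R]_n) : set 'cV[R]_m :=
  [set x : 'cV[R]_m | 0 <=mx x /\ B *m x = b].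

(* A point is a triple (Y, z, y). *)
Definition LBB'_feasible (R : numDomainType) (m n : nat) (Q : 'M[R]_m)
    (B : 'M[R]_(n, m)) (b : 'cV[R]_n) :
    set ('M[R]_(n, m) * 'cV[R]_m * 'cV[R]_n) :=
  [set p | let: (Y, z, y) := p in
    B^T *m y <=mx 2 *: (Y^T *m b) + z
    /\ B^T *m Y + Y^T *m B + diag_mx z^T <=mx Q].

Definition RLT1'_feasible (R : numDomainType) (m n : nat)
    (B : 'M[R]_(n, m)) (b : 'cV[R]_n) : set ('cV[R]_m * 'M[R]_m) :=
  [set p | let: (x, X) := p in
    [/\ X^T = X,
        B *m x = b /\ B *m X = b *m x^T,
        x = diag_col X,
        0 <=mx x
      & 0 <=mx X]].

Definition RLT1_feasible (R : numDomainType) (m n : nat)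
    (B : 'M[R]_(n, m)) (b : 'cV[R]_n) : set ('cV[R]_m * 'M[R]_m) :=
  [set p | let: (x, X) := p in
    let e := ones R m in
    [/\ RLT1'_feasible B b (x, X),
        0 <=mx e - x,
        0 <=mx const_mx 1 - x *m e^T - e *m x^T + X
      & 0 <=mx x *m e^T - X]].

(* Optimal values are suprema / infima in the extended reals, so that an
   infeasible maximization (minimization) has value -oo (+oo). *)
Definition v_LBB' (R : realType) (m n : nat) (Q : 'M[R]_m)
    (B : 'M[R]_(n, m)) (b : 'cV[R]_n) : \bar R :=
  ereal_sup [set (mxdot b p.2)%:E | p in LBB'_feasible Q B b].

Definition v_RLT1' (R : realType) (m n : nat) (Q : 'M[R]_m)
    (B : 'M[R]_(n, m)) (b : 'cV[R]_n) : \bar R :=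
  ereal_inf [set (mxdot Q p.2)%:E | p in RLT1'_feasible B b].

Definition v_RLT1 (R : realType) (m n : nat) (Q : 'M[R]_m)
    (B : 'M[R]_(n, m)) (b : 'cV[R]_n) : \bar R :=
  ereal_inf [set (mxdot Q p.2)%:E | p in RLT1_feasible B b].

(* Main.v *)
(** The maximization problem is the linear programming dual of the reduced RLT
relaxation: a certificate provided by Farkas' lemma for the dual, homogenized
by a scalar, is a primal feasible matrix once symmetrized. Farkas' lemma itself
goes by induction on the number of functionals (Bartl's algebraic proof). For
the second equality, if [(x, X)] is feasible for the reduced relaxation, the
vectors [X_j] and [x - X_j] are nonnegative solutions of [B v = t b] with
[t = x_j] and [t = 1 - x_j] respectively, so the redundancy of [x <= e] gives
[v <= t e], which are the constraints left out by the reduced relaxation. *)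
Require Import Defs.
From mathcomp Require Import all_boot all_order all_algebra.
From mathcomp Require Import all_classical all_reals ereal.
From mathcomp Require Import ring lra.

Import Order.TTheory GRing.Theory Num.Theory.

Local Open Scope classical_set_scope.
Local Open Scope ring_scope.

(** * Farkas' lemma for linear functionals *)

Lemma scalar0 (R : pzRingType) (V : lmodType R) (f : V -> R) :
  scalar f -> f 0 = 0.
Proof. by move=> fL; have := fL (-1) 0 0; rewrite scaler0 addr0 mulN1r addNr. Qed.

Lemma scalarN (R : pzRingType) (V : lmodType R) (f : V -> R) v :
  scalar f -> f (- v) = - f v.
Proof.
by move=> fL; have := fL (-1) v 0; rewrite scaleN1r addr0 mulN1r scalar0 ?addr0.
Qed.

Lemma scalarZ (R : pzRingType) (V : lmodType R) (f : V -> R) a v :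
  scalar f -> f (a *: v) = a * f v.
Proof. by move=> fL; have := fL a v 0; rewrite scalar0 // !addr0. Qed.

Lemma farkas_seq (R : realFieldType) (V : lmodType R) (I : eqType)
    (s : seq I) (alpha : I -> V -> R) (gamma : V -> R) :
  uniq s -> (forall i, scalar (alpha i)) -> scalar gamma ->
  (forall v, (forall i, i \in s -> alpha i v <= 0) -> gamma v <= 0) ->
  exists2 u : I -> R, (forall i, 0 <= u i) &
    forall v, gamma v = \sum_(i <- s) u i * alpha i v.
Proof.
elim: s => [|k s IHs] in alpha gamma *.
  move=> _ _ gammaL le0; exists (fun=> 0) => // v; rewrite big_nil.
  (* With no functionals, [gamma] is nonpositive at both [v] and [- v]. *)
  apply/eqP; rewrite eq_le le0 //= -oppr_le0 -scalarN //; exact: le0.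
move=> /= /andP[ks us] alphaL gammaL le0.
have [le0'|] := pselect (forall v,
    (forall i, i \in s -> alpha i v <= 0) -> gamma v <= 0).
  have [u u0 uE] := IHs _ _ us alphaL gammaL le0'.
  exists (fun i => if i == k then 0 else u i) => [i|v]; first by case: ifP.
  rewrite big_cons eqxx mul0r add0r uE; apply: eq_big_seq => i si.
  by case: eqP => // ik; rewrite -ik si in ks.
move=> /existsNP[w1 /not_implyP[w1s /negP]]; rewrite -ltNge => gw1.
(* [w1] meets every constraint of [s], so [gamma w1 > 0] forces it to violate that of [k]. *)
have aw1 : 0 < alpha k w1.
  rewrite ltNge; apply/negP => akw1; move: gw1; rewrite ltNge le0 // => i.
  by rewrite inE => /orP[/eqP->//|/w1s].
pose w := (alpha k w1)^-1 *: w1.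
have akw : alpha k w = 1 by rewrite scalarZ // mulVf // gt_eqF.
have gw : 0 < gamma w by rewrite scalarZ // mulr_gt0 // invr_gt0.
have ws i : i \in s -> alpha i w <= 0.
  by move=> si; rewrite scalarZ // pmulr_rle0 ?invr_gt0 // w1s.
(* Project along [w] onto the kernel of [alpha k]. *)
pose pr (f : V -> R) v := f v - f w * alpha k v.
have prL f : scalar f -> scalar (pr f).
  by move=> fL a x y; rewrite /pr fL (alphaL k); ring.
have prE f v : scalar f -> pr f v = f (- alpha k v *: w + v).
  by move=> fL; rewrite fL /pr; ring.
have [||v prs|u u0 uE] := IHs (fun i => pr (alpha i)) (pr gamma) us.
- by move=> i; apply: prL.
- exact: prL.
- rewrite prE //; apply: le0 => i; rewrite inE => /orP[/eqP->|/prs].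
    by rewrite alphaL akw mulr1 addNr.
  by rewrite prE.
(* This is the coefficient of [alpha k v] once the projected identity is expanded; it is nonnegative
   because [gamma w > 0] and [alpha i w <= 0] on [s]. *)
pose c := gamma w - \sum_(i <- s) u i * alpha i w.
exists (fun i => if i == k then c else u i) => [i|v].
  case: ifP => // _; rewrite subr_ge0 (le_trans _ (ltW gw)) // big_seq.
  by apply: sumr_le0 => j sj; rewrite mulr_ge0_le0 // ws.
rewrite big_cons eqxx.
have -> : \sum_(i <- s) (if i == k then c else u i) * alpha i v =
          \sum_(i <- s) u i * alpha i v.
  by apply: eq_big_seq => i si; case: eqP => // ik; rewrite -ik si in ks.
have := uE v; rewrite /pr /c.
under eq_bigr do rewrite mulrBr mulrA.
by rewrite sumrB -mulr_suml => /eqP; rewrite subr_eq => /eqP ->; ring.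
Qed.

Lemma farkas (R : realFieldType) (V : lmodType R) (I : finType)
    (alpha : I -> V -> R) (gamma : V -> R) :
  (forall i, scalar (alpha i)) -> scalar gamma ->
  (forall v, (forall i, alpha i v <= 0) -> gamma v <= 0) ->
  exists2 u : I -> R, (forall i, 0 <= u i) &
    forall v, gamma v = \sum_i u i * alpha i v.
Proof.
move=> alphaL gammaL le0; apply: farkas_seq (index_enum_uniq I) _ _ _ => // v.
by move=> vs; apply: le0 => i; apply: vs; rewrite mem_index_enum.
Qed.

(** * The trace inner product *)

Section MatrixDot.
Variables (R : numDomainType) (p q : nat).
Implicit Types A C D : 'M[R]_(p, q).

Lemma mxdotE A C : mxdot A C = \sum_i \sum_j A i j * C i j.
Proof.
rewrite /mxdot /mxtrace exchange_big; apply: eq_bigr => j _.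
by rewrite mxE; apply: eq_bigr => i _; rewrite mxE.
Qed.

Lemma mxdotC A C : mxdot A C = mxdot C A.
Proof. by rewrite /mxdot -mxtrace_tr trmx_mul trmxK. Qed.

Lemma mxdot_tr A C : mxdot A^T C^T = mxdot A C.
Proof. by rewrite /mxdot trmxK mxtrace_mulC -mxtrace_tr trmx_mul trmxK. Qed.

Lemma mxdotDr A C D : mxdot A (C + D) = mxdot A C + mxdot A D.
Proof. by rewrite /mxdot mulmxDr mxtraceD. Qed.

Lemma mxdotZr A a C : mxdot A (a *: C) = a * mxdot A C.
Proof. by rewrite /mxdot -scalemxAr mxtraceZ. Qed.

Lemma mxdotNr A C : mxdot A (- C) = - mxdot A C.
Proof. by rewrite -scaleN1r mxdotZr mulN1r. Qed.

Lemma mxdotDl A C D : mxdot (C + D) A = mxdot C A + mxdot D A.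
Proof. by rewrite ![mxdot _ A]mxdotC mxdotDr. Qed.

Lemma mxdotZl A a C : mxdot (a *: C) A = a * mxdot C A.
Proof. by rewrite ![mxdot _ A]mxdotC mxdotZr. Qed.

Lemma mxdotNl A C : mxdot (- C) A = - mxdot C A.
Proof. by rewrite ![mxdot _ A]mxdotC mxdotNr. Qed.

Lemma mxdot0l A : mxdot 0 A = 0.
Proof. by rewrite -(scale0r A) mxdotZl mul0r. Qed.

Lemma mxdot_delta A i j : mxdot A (delta_mx i j) = A i j.
Proof.
rewrite mxdotE (bigD1 i) //= (bigD1 j) //= mxE !eqxx mulr1 !big1 ?addr0 //.
  by move=> k ki; rewrite big1 // => l _; rewrite mxE (negPf ki) mulr0.
by move=> l lj; rewrite mxE (negPf lj) andbF mulr0.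
Qed.

Lemma mxdot_eq0 A : (forall C, mxdot A C = 0) -> A = 0.
Proof. by move=> A0; apply/matrixP => i j; rewrite -mxdot_delta A0 mxE. Qed.

Lemma ler_mxdot A C D : 0 <=mx A -> C <=mx D -> mxdot A C <= mxdot A D.
Proof.
move=> A0 CD; rewrite !mxdotE; apply: ler_sum => i _; apply: ler_sum => j _.
by rewrite ler_wpM2l //; have := A0 i j; rewrite mxE.
Qed.

End MatrixDot.

Lemma mxdot_diag (R : numDomainType) (m : nat) (X : 'M[R]_m) (z : 'cV[R]_m) :
  mxdot X (diag_mx z^T) = mxdot (diag_col X) z.
Proof.
rewrite !mxdotE; apply: eq_bigr => i _; rewrite big_ord1 !mxE.
rewrite (bigD1 i) //= big1 ?addr0 => [|j ji]; first by rewrite !mxE eqxx mulr1n.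
by rewrite !mxE eq_sym (negPf ji) mulr0n mulr0.
Qed.

(* The Lagrangian of the reduced RLT relaxation, with its terms collected first
   by primal and then by dual variables. *)
Lemma lagrangianE (R : numDomainType) (m n : nat) (B : 'M[R]_(n, m))
    (b : 'cV[R]_n) (X : 'M[R]_m) (x : 'cV[R]_m) (Y : 'M[R]_(n, m))
    (z : 'cV[R]_m) (y : 'cV[R]_n) :
  mxdot X (B^T *m Y + Y^T *m B + diag_mx z^T)
    + mxdot x (B^T *m y - (2 *: (Y^T *m b) + z)) =
  mxdot (B *m (X + X^T) - 2 *: (b *m x^T)) Y
    + mxdot (diag_col X - x) z + mxdot (B *m x) y.
Proof.
have adj k l p (C : 'M[R]_(k, l)) (D : 'M_(l, p)) E :
    mxdot D (C^T *m E) = mxdot (C *m D) E.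
  by rewrite /mxdot trmx_mul mulmxA.
have YB : mxdot X (Y^T *m B) = mxdot (B *m X^T) Y.
  by rewrite -mxdot_tr trmx_mul trmxK adj.
have Yb : mxdot x (Y^T *m b) = mxdot (b *m x^T) Y.
  by rewrite /mxdot -mxtrace_tr !trmx_mul !trmxK mxtrace_mulC mulmxA.
rewrite mulmxDr !(mxdotDr, mxdotDl, mxdotNr, mxdotNl, mxdotZr, mxdotZl, opprD).
rewrite YB Yb !adj mxdot_diag; ring.
Qed.

(** * Weak and strong duality *)

Section Duality.
Variables (R : realType) (m n : nat) (B : 'M[R]_(n, m)) (b : 'cV[R]_n).

(** The primal equations reduce the right side of [lagrangianE] to [mxdot b y]; on the left,
    nonnegativity of [X] and [x] bounds the first term by [mxdot X Q] and the second by 0. *)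
Lemma weak_duality (Q : 'M[R]_m) p q :
  LBB'_feasible Q B b p -> RLT1'_feasible B b q ->
  mxdot b p.2 <= mxdot Q q.2.
Proof.
case: p q => [[Y z] y] [x X] /= [By GQ] [Xs [Bx BX] xX x0 X0].
have := lagrangianE _ _ _ B b X x Y z y.
rewrite Xs -mulr2n -(scaler_nat 2 X) -scalemxAr BX -xX !subrr !mxdot0l Bx !add0r.
move=> <-; rewrite (mxdotC _ _ _ Q) -[leRHS]addr0 lerD ?ler_mxdot //.
rewrite -[leRHS](mxdot0l _ _ _ x) [leRHS]mxdotC ler_mxdot // => i j.
by have := By i j; rewrite !mxE; lra.
Qed.

(** The bound [r] stands for any real above the dual value, which also covers an infeasible dual. *)
Lemma strong_duality (Q : 'M[R]_m) (Qsym : Q^T = Q) (r : R) :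
  RLT1'_feasible B b !=set0 ->
  (forall p, LBB'_feasible Q B b p -> mxdot b p.2 <= r) ->
  exists2 q, RLT1'_feasible B b q & mxdot Q q.2 <= r.
Proof.
move=> [q0 q0F] ub.
pose V : lmodType R := ('M[R]_(n, m) * 'cV[R]_m * 'cV[R]_n * R^o)%type.
pose G (v : V) := B^T *m v.1.1.1 + v.1.1.1^T *m B + diag_mx v.1.1.2^T - v.2 *: Q.
pose H (v : V) := B^T *m v.1.2 - (2 *: (v.1.1.1^T *m b) + v.1.1.2).
(* The dual homogenized by a scalar [t = v.2 >= 0]. *)
pose alpha (i : 'I_m * 'I_m + 'I_m + unit) (v : V) : R :=
  match i with
  | inl (inl ij) => G v ij.1 ij.2
  | inl (inr i) => H v i 0
  | inr _ => - v.2
  end.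
pose gamma (v : V) : R := mxdot b v.1.2 - r * v.2.
have linG a u v : G (a *: u + v) = a *: G u + G v.
  apply/matrixP => i j; rewrite /G /= !linearP /= !mulmxDl -!scalemxAl.
  rewrite !mxE -[a *: u.2]/(a * u.2); ring.
have linH a u v : H (a *: u + v) = a *: H u + H v.
  apply/matrixP => i j; rewrite /H /= !linearP /= !mulmxDl -!scalemxAl.
  rewrite !mxE; ring.
have [||v v0|u u0 uE] := @farkas R V _ alpha gamma.
- move=> [[[i j]|i]|[]] a u v /=.
  + by rewrite linG !mxE.
  + by rewrite linH !mxE.
  + by rewrite mulrN -opprD.
- by move=> a u v; rewrite /gamma /= mxdotDr mxdotZr -[a *: u.2]/(a * u.2); ring.
- have Gv i j : G v i j <= 0 by apply: (v0 (inl (inl (i, j)))).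
  have Hv i j : H v i j <= 0.
    by rewrite ord1; apply: (v0 (inl (inr i))).
  have t0 : 0 <= v.2 by have := v0 (inr tt); rewrite /= oppr_le0.
  (* At [t = 0] the triple is dual feasible for [Q = 0], so weak duality against [q0] gives
     [mxdot b y <= 0]. *)
  have [t_eq0|t_neq0] := eqVneq v.2 0.
    rewrite /gamma t_eq0 mulr0 subr0 -(mxdot0l _ _ _ q0.2).
    apply: (weak_duality 0 v.1) => //; case: v Gv Hv t_eq0 {v0 t0} => [[[Y z] y] t].
    rewrite /G /H /= => Gv Hv t_eq0; split=> i j.
      by have := Hv i j; rewrite !mxE subr_le0.
    by rewrite [leRHS]mxE; have := Gv i j; rewrite t_eq0 scale0r subr0.
  have t_gt0 : 0 < v.2 by rewrite lt_def t_neq0.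
  (* For [t > 0], dividing by [t] gives a dual feasible point, to which [ub] applies. *)
  have /= := ub (v.2^-1 *: v.1).
  case: v Gv Hv t_neq0 t_gt0 {v0 t0} => [[[Y z] y] t].
  rewrite /G /H /gamma /= => Gv Hv t_neq0 t_gt0.
  rewrite mxdotZr subr_le0 mulrC ler_pdivrMr //; apply.
  have tV_ge0 : 0 <= t^-1 by rewrite invr_ge0 ltW.
  split=> i j.
    have := mulr_ge0_le0 tV_ge0 (Hv i j); rewrite !linearZ /= -scalemxAl.
    rewrite !mxE; lra.
  have := mulr_ge0_le0 tV_ge0 (Gv i j); rewrite !linearZ /= -scalemxAl !mxE.
  by rewrite mulrDr mulKf //; lra.
(* The Farkas multipliers: [X] for the matrix inequality, [x] for the vector one, [w] for
   [t >= 0]. *)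
pose X := \matrix_(i, j) u (inl (inl (i, j))).
pose x := \col_i u (inl (inr i)).
pose w := u (inr tt).
(* The Farkas identity is linear in [(Y, z, y, t)], so keeping one variable and setting the others
   to 0 yields one primal equation at a time, and the objective from [t]. *)
have key Y z y t : mxdot b y - r * t =
    mxdot (B *m (X + X^T) - 2 *: (b *m x^T)) Y + mxdot (diag_col X - x) z
    + mxdot (B *m x) y - (mxdot X Q + w) * t.
  rewrite -lagrangianE; have := uE (Y, z, y, t); rewrite /gamma /= => ->.
  rewrite !big_sumType /= (big_pred1 tt) => [|[]//].
  have -> : \sum_i u (inl (inl i)) * G (Y, z, y, t) i.1 i.2 =
      mxdot X (B^T *m Y + Y^T *m B + diag_mx z^T) - mxdot X Q * t.
    rewrite mulrC -mxdotZr -mxdotNr -mxdotDr mxdotE pair_big /=.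
    by apply: eq_bigr => -[i j] _; rewrite [X _ _]mxE.
  have -> : \sum_i u (inl (inr i)) * H (Y, z, y, t) i 0 =
      mxdot x (B^T *m y - (2 *: (Y^T *m b) + z)).
    by rewrite mxdotE; apply: eq_bigr => i _; rewrite big_ord1 [x _ _]mxE.
  by rewrite /w; ring.
have BX : B *m (X + X^T) = 2 *: (b *m x^T).
  apply/eqP; rewrite -subr_eq0; apply/eqP/mxdot_eq0 => Y.
  have := key Y 0 0 0; rewrite ![mxdot _ 0]mxdotC !mxdot0l; lra.
have xX : x = diag_col X.
  apply/esym/eqP; rewrite -subr_eq0; apply/eqP/mxdot_eq0 => z.
  have := key 0 z 0 0; rewrite ![mxdot _ 0]mxdotC !mxdot0l; lra.
have Bx : B *m x = b.
  apply/eqP; rewrite -subr_eq0; apply/eqP/mxdot_eq0 => y.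
  have := key 0 0 y 0; rewrite ![mxdot _ 0]mxdotC !mxdot0l mxdotDl mxdotNl; lra.
have XQ : mxdot X Q + w = r.
  have := key 0 0 0 1; rewrite ![mxdot _ 0]mxdotC !mxdot0l; lra.
(* Symmetrizing keeps the diagonal and, as [Q] is symmetric, the objective, which equals [r - w]. *)
exists (x, 2^-1 *: (X + X^T)) => /=.
  split=> //.
  - by rewrite linearZ linearD /= trmxK addrC.
  - by rewrite -scalemxAr BX scalerA mulVf ?pnatr_eq0 ?scale1r.
  - by rewrite xX; apply/matrixP => i j; rewrite !mxE; field.
  - by move=> i j; rewrite !mxE u0.
  - by move=> i j; rewrite !mxE mulr_ge0 ?invr_ge0 ?addr_ge0.
rewrite mxdotZr mxdotDr -{2}Qsym mxdot_tr mxdotC -XQ.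
by have := u0 (inr tt); rewrite -/w; lra.
Qed.

End Duality.

(* For [t > 0] rescale [v] into [continuous_set B b]; for [t = 0], [v] is a
   recession direction of this bounded set, hence zero. *)
Lemma le_scaled_ones (R : realType) (m n : nat) (B : 'M[R]_(n, m))
    (b : 'cV[R]_n) (v : 'cV[R]_m) (t : R) :
  continuous_set B b !=set0 ->
  (forall x, continuous_set B b x -> x <=mx ones R m) ->
  0 <= t -> 0 <=mx v -> B *m v = t *: b -> forall i, v i 0 <= t.
Proof.
move=> [x0 [x00 Bx0]] le1 t0 v0 Bv i; have vi0 : 0 <= v i 0.
  by have := v0 i 0; rewrite mxE.
have [t_eq0|t_neq0] := eqVneq t 0; last first.
  have t_gt0 : 0 < t by rewrite lt_def t_neq0.
  suff /le1/(_ i 0) : continuous_set B b (t^-1 *: v).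
    by rewrite !mxE mulrC ler_pdivrMr // mul1r.
  split=> [j k|]; first by have := v0 j k; rewrite !mxE => ?; rewrite mulr_ge0 ?invr_ge0.
  by rewrite -scalemxAr Bv scalerA mulVf // scale1r.
rewrite t_eq0 leNgt; apply/negP => vi_gt0.
(* The factor [2 / v i 0] raises coordinate [i] to at least 2. *)
have /le1/(_ i 0) : continuous_set B b (x0 + (2 / v i 0) *: v).
  split=> [j k|]; last by rewrite mulmxDr -scalemxAr Bv t_eq0 scale0r scaler0 addr0.
  have := v0 j k; have := x00 j k; rewrite !mxE => ? ?.
  by rewrite addr_ge0 ?mulr_ge0 ?invr_ge0 ?ler0n.
rewrite !mxE mulfVK ?gt_eqF //.
by have := x00 i 0; rewrite mxE; lra.
Qed.

Lemma RLT1'_sub_RLT1 (R : realType) (m n : nat) (B : 'M[R]_(n, m))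
    (b : 'cV[R]_n) :
  (forall x, continuous_set B b x -> x <=mx ones R m) ->
  RLT1'_feasible B b `<=` RLT1_feasible B b.
Proof.
move=> le1 [x X] F; have [Xs [Bx BX] xX x0 X0] := F.
have Kx : continuous_set B b x by [].
have le1' v t := le_scaled_ones _ _ _ B b v t (ex_intro _ x Kx) le1.
have xi0 i : 0 <= x i 0 by have := x0 i 0; rewrite mxE.
have xi1 i : x i 0 <= 1 by have := le1 _ Kx i 0; rewrite mxE.
have BXj j : B *m col j X = x j 0 *: b.
  rewrite colE mulmxA BX -colE; apply/matrixP => i k.
  by rewrite !mxE big_ord1 !mxE (ord1 k) mulrC.
have XC i j : X i j = X j i by rewrite -[in LHS]Xs mxE.
have Xx i j : X i j <= x j 0.
  have := le1' (col j X) (x j 0) (xi0 j) _ (BXj j) i; rewrite mxE; apply.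
  by move=> k l; rewrite !mxE; have := X0 k j; rewrite mxE.
(* Here [x - col j X] is nonnegative by [Xx] and the symmetry of [X]. *)
have xX1 i j : x i 0 - X i j <= 1 - x j 0.
  have := le1' (x - col j X) (1 - x j 0) _ _ _ i; rewrite !mxE; apply.
  - by rewrite subr_ge0.
  - by move=> k l; rewrite !mxE ord1 subr_ge0 XC.
  - by rewrite mulmxBr Bx BXj scalerBl scale1r.
split=> // i j; rewrite !mxE ?big_ord1 ?mxE ?mulr1 ?mul1r.
- by rewrite subr_ge0 ord1.
- by have := xX1 i j; lra.
- by rewrite subr_ge0 XC.
Qed.

Theorem lemma6p2 (R : realType) (m n : nat)
    (Q : 'M[R]_m) (B : 'M[R]_(n, m)) (b : 'cV[R]_n)
    (Qsym : Q^T = Q)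
    (K_nonempty : binary_set B b !=set0)
    (le_e_redundant : forall x : 'cV[R]_m, continuous_set B b x ->
       x <=mx ones R m) :
  v_LBB' Q B b = v_RLT1' Q B b /\ v_RLT1' Q B b = v_RLT1 Q B b.
Proof.
have RLT1E : RLT1_feasible B b = RLT1'_feasible B b.
  by apply/seteqP; split=> [[x X] []//|]; apply: RLT1'_sub_RLT1.
split; last by rewrite /v_RLT1 RLT1E.
have F0 : RLT1'_feasible B b !=set0.
  (* A binary solution lifts to [x *m x^T], whose diagonal is [x] because 0 and 1 are their own
     squares. *)
  have [x [x01 Bx]] := K_nonempty; exists (x, x *m x^T).
  have x0 i : 0 <= x i 0 by case: (x01 i) => ->.
  split.
  - by rewrite trmx_mul trmxK.
  - by rewrite mulmxA Bx.
  - apply/matrixP => i j; rewrite !mxE big_ord1 !mxE ord1.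
    by case: (x01 i) => ->; rewrite ?mulr0 ?mulr1.
  - by move=> i j; rewrite mxE ord1.
  - by move=> i j; rewrite !mxE big_ord1 !mxE mulr_ge0.
apply/le_anti/andP; split.
  apply: ge_ereal_sup => _ [p pF <-]; apply: le_ereal_inf_tmp => _ [q qF <-].
  by rewrite lee_fin; apply: weak_duality pF qF.
(* Testing against every real [r] settles a dual value of -oo too: every [r] then bounds the primal
   value from above. *)
have le_fin r : (v_LBB' Q B b <= r%:E -> v_RLT1' Q B b <= r%:E)%E.
  move=> le_r; have [p pF|q qF qr] := strong_duality _ _ _ _ _ _ Qsym r F0.
    rewrite -lee_fin; apply: le_trans le_r; apply: ereal_sup_ubound.
    by exists p.
  apply: (@le_trans _ _ (mxdot Q q.2)%:E); last by rewrite lee_fin.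
  by apply: ereal_inf_lbound; exists q.
case: (v_LBB' Q B b) le_fin => [r| |] le_fin; first exact: le_fin.
- exact: leey.
- by rewrite leeNy_eq; apply/eqP/eq_ninfty => r; apply/le_fin/leNye.
Qed.
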